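(* Let $\widetilde\varphi$ and $\widehat\varphi$ be Weyl functions of two discrete Dirac type systems (with $2p\times 2p$ coefficients) $$W_{k+1}(\lambda)-W_k(\lambda)=-\frac i\lambda \widetilde C_kW_k(\lambda)\quad(0\le k\le\widetilde n),\qquad W_{k+1}(\lambda)-W_k(\lambda)=-\frac i\lambda \widehat C_kW_k(\lambda)\quad(0\le k\le\widehat n),$$ respectively, each of which satisfies the conditions (D) stated in the context. Denote the Taylor coefficients at $z=0$ of $\widetilde\varphi\big(i\,\frac{1+z}{1-z}\big)$ and $\widehat\varphi\big(i\,\frac{1+z}{1-z}\big)$ by $\{\widetilde\alpha_k\}$ and $\{\widehat\alpha_k\}$, respectively, and assume that $\widetilde\alpha_k=\widehat\alpha_k$ for $0\le k\le l$, where $l\le\widetilde n$ and $l\le\widehat n$. Then $\widetilde C_k=\widehat C_k$ for $0\le k\le l$.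
   Context: **Conditions (D)** on a system $W_{k+1}(\lambda)-W_k(\lambda)=-\frac i\lambda C_kW_k(\lambda)$, $0\le k\le n$: $C_k=C_k^*=C_k^{-1}$ and $$C_k=I_{2p}-2\beta(k)^*\beta(k),\qquad \beta(k)\beta(k)^*=I_p\qquad(0\le k\le n)$$ for some $p\times2p$ matrices $\beta(k)=[\beta_1(k)\quad\beta_2(k)]$ ($p\times p$ blocks) such that $$\det\beta_1(0)\ne0,\qquad\det\big(\beta(k-1)\beta(k)^*\big)\ne0\quad(0<k\le n).$$ **Weyl functions of the system on $0\le k\le n$.** Let $W_k(\lambda)$ be the $2p\times2p$ solution normalized by $W_0(\lambda)=I_{2p}$, and put $\mathcal W(\lambda)=\{\mathcal W_{ij}(\lambda)\}_{i,j=1}^2=W_{n+1}(\overline\lambda)^*$, with $p\times p$ blocks $\mathcal W_{ij}$. A pair $R,Q$ of $p\times p$ matrix functions analytic in a neighborhood of $\lambda=i$ is called admissible if $\det\big(\mathcal W_{21}(i)R(i)+\mathcal W_{22}(i)Q(i)\big)\ne0$. The Weyl functions of the system are the matrix functions (considered near $\lambda=i$) $$\varphi(\lambda)=\big(\mathcal W_{11}(\lambda)R(\lambda)+\mathcal W_{12}(\lambda)Q(\lambda)\big)\big(\mathcal W_{21}(\lambda)R(\lambda)+\mathcal W_{22}(\lambda)Q(\lambda)\big)^{-1}$$ with $R,Q$ admissible. *)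

(* Defs.v *)
From HB Require Import structures.
From mathcomp Require Import all_boot all_order all_algebra.
From mathcomp Require Import all_classical all_reals all_analysis.
From mathcomp Require Import complex.

Set Implicit Arguments.
Unset Strict Implicit.
Unset Printing Implicit Defensive.

Import Order.TTheory GRing.Theory Num.Theory.
Import numFieldNormedType.Exports.

Local Open Scope classical_set_scope.
Local Open Scope ring_scope.
Local Open Scope sesquilinear_scope.

(* Seen as a numClosedFieldType, R[i] carries the topology of its norm, and
   matrices over it the entrywise topology. *)
Definition Cplx (R : realType) : numClosedFieldType := R[i].

Section PowerSeries.
Variables (R : realType) (m n : nat).
Implicit Types (f : Cplx R -> 'M[Cplx R]_(m, n)) (w : Cplx R).

(* The Taylor coefficients of an analytic function are defined as the
   (unique) coefficients of a power series at w that converges to f on a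
   neighborhood of w. *)
Definition taylor_coefs f w (a : nat -> 'M[Cplx R]_(m, n)) : Prop :=
  \forall z \near w, [series (z - w) ^+ j *: a j]_j @ \oo --> f z.

Definition analytic_near f w : Prop :=
  \forall v \near w, exists a, taylor_coefs f v a.

End PowerSeries.

Section DiracSystem.
Variables (R : realType) (p : nat).
Let K : numClosedFieldType := Cplx R.
Implicit Types (n : nat) (C : nat -> 'M[K]_(p + p)).

(* Only C 0, ..., C n matter.  The unitmx clause is needed because invmx is
   the identity on singular matrices. *)
Definition conditions_D n C : Prop :=
  (forall k, (k <= n)%N ->
     [/\ C k = (C k)^t*, C k \in unitmx & C k = invmx (C k)]) /\
  exists beta : nat -> 'M[K]_(p, p + p),
    [/\ forall k, (k <= n)%N ->
          C k = 1%:M - 2%:R *: ((beta k)^t* *m beta k),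
        forall k, (k <= n)%N -> beta k *m (beta k)^t* = 1%:M,
        \det (lsubmx (beta 0%N)) != 0
      & forall k, (0 < k <= n)%N ->
          \det (beta k.-1 *m (beta k)^t*) != 0].

Definition normalized_solution n C (W : nat -> K -> 'M[K]_(p + p)) : Prop :=
  forall lambda : K, lambda != 0 ->
    W 0%N lambda = 1%:M /\
    forall k, (k <= n)%N ->
      W k.+1 lambda - W k lambda = - ('i / lambda) *: (C k *m W k lambda).

Definition calW n (W : nat -> K -> 'M[K]_(p + p)) (lambda : K) :
  'M[K]_(p + p) := (W n.+1 (Num.conj lambda))^t*.

Definition admissible n (W : nat -> K -> 'M[K]_(p + p))
    (P Q : K -> 'M[K]_p) : Prop :=
  [/\ analytic_near P 'i, analytic_near Q 'i
    & \det (dlsubmx (calW n W 'i) *m P 'i + drsubmx (calW n W 'i) *m Q 'i)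
        != 0].

(* Weyl functions are germs at lambda = i: the values of phi away from i are
   irrelevant. *)
Definition is_weyl n C (phi : K -> 'M[K]_p) : Prop :=
  exists (W : nat -> K -> 'M[K]_(p + p)) (P Q : K -> 'M[K]_p),
    [/\ normalized_solution n C W, admissible n W P Q
      & \forall lambda \near ('i : K),
          phi lambda =
            (ulsubmx (calW n W lambda) *m P lambda
               + ursubmx (calW n W lambda) *m Q lambda)
            *m invmx (dlsubmx (calW n W lambda) *m P lambda
                        + drsubmx (calW n W lambda) *m Q lambda)].

End DiracSystem.

Definition cayley (R : realType) (z : Cplx R) : Cplx R :=
  'i * ((1 + z) / (1 - z)).

(* Main.v *)
(** In the variable [z] with [lambda = cayley z], the factor
    [I + (i / lambda) C_k] of [calW] equals [2 / (1 + z)] times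
    [(I - P_k) + z P_k], where [P_k = beta(k)^* beta(k)] is a projection, so a
    Weyl function satisfies
    [phi; I] = ((I - P_0) + z P_0) ... ((I - P_n) + z P_n) Y(z)
    with [Y] continuous at [0].  Let [V_k] be the tail of this product starting
    at the [k]-th factor.  Its value at [0] has rank [p] and is killed by
    [beta(k)], hence determines [P_k]; and
    [V_(k+1) = ((I - P_k) + z^-1 P_k) V_k], so if two such tails agree up to
    [o(z^(l-k))] and [k < l], the next ones agree up to [o(z^(l-k-1))]. *)

Require Import Defs.
From mathcomp Require Import all_boot all_order all_algebra.
From mathcomp Require Import all_classical all_reals all_analysis.
From mathcomp Require Import ring.

Set Implicit Arguments.
Unset Strict Implicit.
Unset Printing Implicit Defensive.

Import Order.TTheory GRing.Theory Num.Theory.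
Import numFieldNormedType.Exports.

Local Open Scope classical_set_scope.
Local Open Scope ring_scope.
Local Open Scope sesquilinear_scope.

(** * Scalar power series: order of vanishing and continuity at the centre *)

Section PowerSeries.
Variable K : numFieldType.

(** Convergence at one point [z0] other than [w] bounds the terms there by some [M]. At half that
    distance or closer, the terms are dominated by a geometric sequence that starts at index [m]. *)
Lemma near_pseries_le (c : nat -> K) (f : K -> K) (w : K) (m : nat) :
  (\forall z \near w, [series (z - w) ^+ j * c j]_j @ \oo --> f z) ->
  (forall j, (j < m)%N -> c j = 0) ->
  exists2 M, 0 <= M & \forall z \near w, `|f z| <= M * `|z - w| ^+ m.
Proof.
move=> fc c0; have fc' := nbhs_dnbhs fc.
have [z0 [fz0 z0w]] := filter_ex (filterI fc' (nbhs_dnbhs_neq w)).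
have /cvg_series_cvg_0 u0 : cvgn (series (fun j => (z0 - w) ^+ j * c j)).
  by apply/cvg_ex; exists (f z0).
have [M M_gt0 /= uM] := pinfty_ex_gt0 (cvg_seq_bounded (cvgP _ u0)).
have r_gt0 : 0 < `|z0 - w| by rewrite normr_gt0 subr_eq0.
(* The factor 2 bounds the sum of a geometric series of ratio at most 1/2. *)
exists (M * 2 / `|z0 - w| ^+ m).
  by rewrite divr_ge0 ?exprn_ge0 // mulr_ge0 // ltW.
have small : \forall z \near w, `|w - z| <= `|z0 - w| / 2.
  have r2_gt0 : 0 < `|z0 - w| / 2 by rewrite divr_gt0.
  exact: (@cvgr_dist_le _ K _ (nbhs w) _ idfun w cvg_id _ r2_gt0).
near=> z.
have fz : [series (z - w) ^+ j * c j]_j @ \oo --> f z by near: z.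
have xle : `|w - z| <= `|z0 - w| / 2 by near: z.
pose x := `|z - w| / `|z0 - w|.
have x_ge0 : 0 <= x by rewrite divr_ge0.
have x_le : x <= 2^-1 by rewrite ler_pdivrMr // mulrC distrC.
have x2 : 1 <= 2 * (1 - x).
  by rewrite mulrBr mulr1 lerBrDr -lerBrDl (le_trans (ler_wpM2l _ x_le)) //
    divff // addrK.
have termE j : (z - w) ^+ j * c j =
    ((z - w) / (z0 - w)) ^+ j * ((z0 - w) ^+ j * c j).
  by rewrite mulrA -exprMn divfK // subr_eq0.
have term_le j : `|(z - w) ^+ j * c j| <= M * x ^+ j.
  by rewrite termE normrM mulrC normrX normf_div ler_wpM2r ?exprn_ge0 //; exact: uM.
(* Keeping the subtracted term [x ^+ (k + m)] lets the induction close: one more term costs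
   [M * x ^+ (k + m)], and [x2] shows that the bound grows by at least that much. *)
have S_le k : `|[series (z - w) ^+ j * c j]_j (k + m)%N|
    <= 2 * M * (x ^+ m - x ^+ (k + m)).
  rewrite /series /=; elim: k => [|k IH].
    rewrite add0n subrr mulr0 big_nat big1 ?normr0 // => j /andP[_ jm].
    by rewrite c0 // mulr0.
  rewrite addSn big_nat_recr //=; apply: (le_trans (ler_normD _ _)).
  apply: (le_trans (lerD IH (term_le _))).
  rewrite -subr_ge0.
  have -> : 2 * M * (x ^+ m - x ^+ (k + m).+1) -
      (2 * M * (x ^+ m - x ^+ (k + m)) + M * x ^+ (k + m)) =
      M * x ^+ (k + m) * (2 * (1 - x) - 1) by rewrite exprS; ring.
  by rewrite mulr_ge0 ?subr_ge0 // mulr_ge0 ?exprn_ge0 // ltW.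
have -> : M * 2 / `|z0 - w| ^+ m * `|z - w| ^+ m = 2 * M * x ^+ m.
  by rewrite /x expr_div_n mulrAC -mulrA (mulrC M).
apply/ler_addgt0Pl => e e_gt0.
move: fz; rewrite -(cvg_shiftn m) => /cvgr_dist_le /(_ _ e_gt0) [N _ /(_ N)].
move=> /(_ (leqnn N)) /= fN.
rewrite -[f z](subrK ([series (z - w) ^+ j * c j]_j (N + m)%N)).
apply: (le_trans (ler_normD _ _)); apply: lerD => //.
apply: (le_trans (S_le N)); rewrite ler_wpM2l ?mulr_ge0 ?(ltW M_gt0) //.
by rewrite lerBlDr lerDl exprn_ge0.
Unshelve. all: by end_near.
Qed.

Lemma near_pseries_diff_le (c d : nat -> K) (f g : K -> K) (w : K) (m : nat) :
  (\forall z \near w, [series (z - w) ^+ j * c j]_j @ \oo --> f z) ->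
  (\forall z \near w, [series (z - w) ^+ j * d j]_j @ \oo --> g z) ->
  (forall j, (j < m)%N -> c j = d j) ->
  exists2 M, 0 <= M & \forall z \near w, `|f z - g z| <= M * `|z - w| ^+ m.
Proof.
move=> fc gd cd.
apply: (@near_pseries_le (fun j => c j - d j) (fun z => f z - g z)) => [|j /cd ->];
  last by rewrite subrr.
apply: filterS2 fc gd => z fz gz.
rewrite (_ : series _ = [series (z - w) ^+ j * c j]_j \- [series (z - w) ^+ j * d j]_j).
  exact: cvgB.
apply: funext => k; rewrite /series /= -sumrB.
by apply: eq_bigr => j _; rewrite mulrBr.
Qed.

(** Comparison to first order with the constant series [c 0]: the difference is at most a multiple
    of the distance to [w], and at [w] itself this gives the value. *)
Lemma cvg_pseries (c : nat -> K) (f : K -> K) (w : K) :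
  (\forall z \near w, [series (z - w) ^+ j * c j]_j @ \oo --> f z) ->
  f z @[z --> w] --> f w.
Proof.
move=> fc.
have cstc : \forall z \near w,
    [series (z - w) ^+ j * (c 0%N *+ (j == 0%N))]_j @ \oo --> c 0%N.
  near=> z; rewrite -(cvg_shiftn 1).
  have -> : [sequence [series (z - w) ^+ j * (c 0%N *+ (j == 0%N))]_j
      (k + 1)%N]_k = cst (c 0%N).
    apply: funext => k; rewrite /series /= addn1 big_nat_recl //= expr0 mul1r.
    by rewrite big1 ?addr0 // => j _; rewrite mulr0n mulr0.
  exact: cvg_cst.
have [|M M_ge0 fM] := near_pseries_diff_le (m := 1) fc cstc.
  by case.
have fw : f w = c 0%N.
  apply/eqP; rewrite -subr_eq0 -normr_le0.
  by have := nbhs_singleton fM; rewrite subrr normr0 expr1 mulr0.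
rewrite fw; apply/(@cvgrPdist_lt K K K (nbhs w) _ f) => e e_gt0.
(* [M] may be zero, so the division is by [M + 1]. *)
have M1_gt0 : 0 < M + 1 by rewrite ltr_wpDl.
have e'_gt0 : 0 < e / (M + 1) by rewrite divr_gt0.
have : \forall z \near w, `|w - z| < e / (M + 1).
  exact: (@cvgr_dist_lt _ K _ (nbhs w) _ idfun w cvg_id _ e'_gt0).
apply: filterS2 fM => z fz zw; rewrite distrC (le_lt_trans fz) // expr1 distrC.
apply: (@le_lt_trans _ _ ((M + 1) * `|w - z|)).
  by rewrite ler_wpM2r // lerDl.
by rewrite mulrC -ltr_pdivlMr.
Unshelve. all: by end_near.
Qed.

Lemma cvg_div_exp0 (f : K -> K) (M : K) (m : nat) : 0 <= M ->
  (\forall z \near 0, `|f z| <= M * `|z| ^+ m.+1) ->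
  (z ^+ m)^-1 * f z @[z --> 0^'] --> 0.
Proof.
move=> M_ge0 /nbhs_dnbhs fM; apply/cvgr0Pnorm_lt => e e_gt0.
have M1_gt0 : 0 < M + 1 by rewrite ltr_wpDl.
have e'_gt0 : 0 < e / (M + 1) by rewrite divr_gt0.
have : \forall z \near (0 : K)^', `|z| < e / (M + 1) by exact: dnbhs0_lt.
have := nbhs_dnbhs_neq (0 : K).
apply: filterS3 fM => z fz z0; move=> ze.
rewrite normrM normfV normrX mulrC ltr_pdivrMr ?exprn_gt0 ?normr_gt0 //.
rewrite (le_lt_trans fz) // exprS mulrA ltr_pM2r ?exprn_gt0 ?normr_gt0 //.
apply: (@le_lt_trans _ _ ((M + 1) * `|z|)).
  by rewrite ler_wpM2r // lerDl.
by rewrite mulrC -ltr_pdivlMr.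
Qed.

End PowerSeries.

(** * Entrywise limits of matrix functions along a filter *)

Section EntrywiseConvergence.
Context {K : numFieldType} {T : Type} (F : set_system T) {FF : Filter F}.

Lemma cvg_expr (f : T -> K) (a : K) m :
  f @ F --> a -> f z ^+ m @[z --> F] --> a ^+ m.
Proof.
move=> fa; elim: m => [|m IH]; first exact: cvg_cst.
rewrite exprS; under eq_cvg do rewrite exprS.
exact: cvgM.
Qed.

Definition mx_cvg m n (f : T -> 'M[K]_(m, n)) (A : 'M[K]_(m, n)) :=
  forall i j, f z i j @[z --> F] --> A i j.

Lemma near_mx_cvg m n (f g : T -> 'M[K]_(m, n)) A :
  (\forall z \near F, f z = g z) -> mx_cvg g A -> mx_cvg f A.
Proof.
move=> fg gA i j; apply: cvg_trans (gA i j); apply: near_eq_cvg.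
by apply: filterS fg => z ->.
Qed.

Lemma mx_cvg_cst m n (A : 'M[K]_(m, n)) : mx_cvg (fun=> A) A.
Proof. by move=> i j; exact: cvg_cst. Qed.

Lemma mx_cvgD m n (f g : T -> 'M[K]_(m, n)) A B :
  mx_cvg f A -> mx_cvg g B -> mx_cvg (fun z => f z + g z) (A + B).
Proof.
move=> fA gB i j; rewrite mxE; under eq_cvg do rewrite mxE.
exact: cvgD.
Qed.

Lemma mx_cvgZ m n (a : T -> K) (f : T -> 'M[K]_(m, n)) (b : K) A :
  a @ F --> b -> mx_cvg f A -> mx_cvg (fun z => a z *: f z) (b *: A).
Proof.
move=> ab fA i j; rewrite mxE; under eq_cvg do rewrite mxE.
exact: cvgM.
Qed.

Lemma mx_cvgM m n p (f : T -> 'M[K]_(m, n)) (g : T -> 'M[K]_(n, p)) A B :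
  mx_cvg f A -> mx_cvg g B -> mx_cvg (fun z => f z *m g z) (A *m B).
Proof.
move=> fA gB i j; rewrite mxE; under eq_cvg do rewrite mxE.
by apply: cvg_big => [|k _]; [exact: add_continuous | exact: cvgM].
Qed.

Lemma mx_cvg_dsubmx m1 m2 n (f : T -> 'M[K]_(m1 + m2, n)) A :
  mx_cvg f A -> mx_cvg (fun z => dsubmx (f z)) (dsubmx A).
Proof. by move=> fA i j; rewrite mxE; under eq_cvg do rewrite mxE; apply: fA. Qed.

Lemma mx_cvg_col m1 m2 n (f : T -> 'M[K]_(m1, n)) (g : T -> 'M[K]_(m2, n))
    A B :
  mx_cvg f A -> mx_cvg g B -> mx_cvg (fun z => col_mx (f z) (g z)) (col_mx A B).
Proof.
move=> fA gB i j; rewrite mxE; under eq_cvg do rewrite mxE.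
by case: (fintype.split i) => k; [exact: fA | exact: gB].
Qed.

Lemma cvg_det n (f : T -> 'M[K]_n) A :
  mx_cvg f A -> \det (f z) @[z --> F] --> \det A.
Proof.
move=> fA; apply: cvg_big => [|s _]; first exact: add_continuous.
apply: cvgM; first exact: cvg_cst.
by apply: cvg_big => [|i _]; [exact: mul_continuous | exact: fA].
Qed.

Lemma mx_cvg_adj n (f : T -> 'M[K]_n) A :
  mx_cvg f A -> mx_cvg (fun z => \adj (f z)) (\adj A).
Proof.
move=> fA i j; rewrite mxE; under eq_cvg do rewrite mxE.
apply: cvgM; first exact: cvg_cst.
apply: cvg_det => k k'; rewrite !mxE; under eq_cvg do rewrite !mxE.
exact: fA.
Qed.

(** By Cramer's rule the inverse is the adjugate divided by the determinant. This formula for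
    [invmx] is valid only on invertible matrices, and [f z] is eventually one of them. *)
Lemma mx_cvg_inv n (f : T -> 'M[K]_n) A :
  \det A != 0 -> mx_cvg f A -> mx_cvg (fun z => invmx (f z)) (invmx A).
Proof.
move=> A0 fA.
have fAdet := cvg_det fA.
have f_unit : \forall z \near F, f z \in unitmx.
  apply: filterS (cvgr_neq0 _ fAdet A0) => z /=.
  by rewrite unitmxE unitfE.
have fAdetV : (\det (f z))^-1 @[z --> F] --> (\det A)^-1 by exact: cvgV.
rewrite /invmx unitmxE unitfE A0; apply: near_mx_cvg (mx_cvgZ fAdetV (mx_cvg_adj fA)).
by apply: filterS f_unit => z; rewrite /= => ->.
Qed.

End EntrywiseConvergence.

(** * Projections determined by the matrix that they annihilate *)

(** The left inverse [X] forces [L] to have rank [n], so its left kernel has dimension [m] and is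
    spanned by the [m] independent rows of [b]. *)
Lemma row_span_eq_of_kernel (K : fieldType) m n (b b' : 'M[K]_(m, m + n))
    (L : 'M[K]_(m + n, n)) (X : 'M[K]_(n, m + n)) :
  X *m L = 1%:M -> row_free b -> b *m L = 0 -> b' *m L = 0 ->
  exists S, b' = S *m b.
Proof.
move=> XL b_free /sub_kermxP bL /sub_kermxP b'L.
have rL : \rank L = n.
  apply/eqP; rewrite eqn_leq rank_leq_col -[X in (X <= _)%N](mxrank1 K n) -XL.
  exact: mxrankM_maxr.
have := mxrank_leqif_eq bL; rewrite mxrank_ker rL addnK (eqP b_free).
case=> _; rewrite eqxx => /esym/andP[_ kb].
by exists (b' *m pinvmx b); rewrite mulmxKpV // (submx_trans b'L).
Qed.

(** Both row families are orthonormal bases of the left kernel of [L], so they differ by a unitary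
    factor [S], which cancels in [b^t* *m b]. *)
Lemma projection_eq_of_kernel (K : numClosedFieldType) p
    (b b' : 'M[K]_(p, p + p)) (L : 'M[K]_(p + p, p)) X :
  X *m L = 1%:M ->
  b *m b^t* = 1%:M -> b' *m b'^t* = 1%:M -> b *m L = 0 -> b' *m L = 0 ->
  b^t* *m b = b'^t* *m b'.
Proof.
move=> XL b1 b'1 bL b'L.
have b_free : row_free b by apply/row_freeP; exists (b^t*).
have [S b'E] := row_span_eq_of_kernel XL b_free bL b'L.
have : S *m S^t* = 1%:M.
  move: b'1; rewrite b'E trmx_mul map_mxM mulmxA -(mulmxA S) b1 mulmx1.
  by [].
move/mulmx1C => S1.
by rewrite b'E trmx_mul map_mxM -!mulmxA (mulmxA _ S) S1 mul1mx.
Qed.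

Lemma mulmx_submx_col (F : pzSemiRingType) m1 m2 n1 n2 q
    (A : 'M[F]_(m1 + m2, n1 + n2)) (B : 'M[F]_(n1, q)) (C : 'M[F]_(n2, q)) :
  A *m col_mx B C =
  col_mx (ulsubmx A *m B + ursubmx A *m C) (dlsubmx A *m B + drsubmx A *m C).
Proof. by rewrite -mul_block_col submxK. Qed.

Definition cayley_regular (F : numClosedFieldType) (z : F) : Prop :=
  1 + z != 0 /\ 1 - z != 0.

Lemma near_cayley_regular (F : numClosedFieldType) (A : set F) :
  (forall z : F, cayley_regular z -> A z) -> nbhs (0 : F) A.
Proof.
move=> regA.
have : \forall z \near (0 : F), `|z| < 1 by exact: nbhs0_lt.
apply: filterS => z z1; apply: regA; split; apply/eqP.
  by move=> /eqP; rewrite addr_eq0 => /eqP zE; rewrite -normrN -zE normr1 ltxx in z1.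
by move=> /eqP; rewrite subr_eq0 => /eqP zE; rewrite -zE normr1 ltxx in z1.
Qed.

(** * Blaschke factors and the factorization of a linear fractional transform *)

Section Factorization.
Variables (K : numClosedFieldType) (p : nat).
Implicit Types (b : nat -> 'M[K]_(p, p + p)) (P : 'M[K]_(p + p)) (z : K).

Definition row_proj (b : 'M[K]_(p, p + p)) : 'M[K]_(p + p) := b^t* *m b.

Definition blaschke_factor P z : 'M[K]_(p + p) := 1%:M - P + z *: P.

Definition blaschke_scale z : K := 2 / (1 + z).

Definition blaschke_tail b n k z : 'M[K]_(p + p) :=
  foldr (fun j A => blaschke_factor (row_proj (b j)) z *m A) 1%:M
    (iota k (n.+1 - k)).

Lemma row_proj_idem (b : 'M[K]_(p, p + p)) :
  b *m b^t* = 1%:M -> row_proj b *m row_proj b = row_proj b.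
Proof. by move=> b1; rewrite /row_proj mulmxA -(mulmxA _ b) b1 mulmx1. Qed.

Lemma blaschke_factorK P z : P *m P = P -> z != 0 ->
  blaschke_factor P z^-1 *m blaschke_factor P z = 1%:M.
Proof.
move=> PP z0.
have PQ : P *m (1%:M - P) = 0 by rewrite mulmxBr mulmx1 PP subrr.
have QP : (1%:M - P) *m P = 0 by rewrite mulmxBl mul1mx PP subrr.
have QQ : (1%:M - P) *m (1%:M - P) = 1%:M - P by rewrite mulmxBl mul1mx PQ subr0.
rewrite /blaschke_factor; move: (1%:M - P) (subrK P 1%:M) PQ QP QQ => Q QP1 PQ QP QQ.
rewrite mulmxDl !mulmxDr -!scalemxAl -!scalemxAr PQ QP QQ PP !scaler0.
by rewrite addr0 add0r scalerA mulVf // scale1r.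
Qed.

(** On [1%:M - P] the coefficient is 1 + (1 - z)/(1 + z) = 2/(1 + z); on [P] it is 1 - (1 - z)/(1 +
    z) = 2z/(1 + z). *)
Lemma mulmx_blaschke_factor (A P : 'M[K]_(p + p)) z : 1 + z != 0 ->
  A + ((1 - z) / (1 + z)) *: (A *m (1%:M - 2%:R *: P)) =
  blaschke_scale z *: (A *m blaschke_factor P z).
Proof.
move=> z1; rewrite /blaschke_scale /blaschke_factor mulmxDr !mulmxBr -!scalemxAr mulmx1.
move: (A *m P) => AP; apply/matrixP => i j; rewrite !mxE; field.
by rewrite z1.
Qed.

Lemma blaschke_tailS b n k z : (k <= n)%N ->
  blaschke_tail b n k z =
  blaschke_factor (row_proj (b k)) z *m blaschke_tail b n k.+1 z.
Proof. by move=> kn; rewrite /blaschke_tail subSn //= subSS. Qed.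

Lemma blaschke_tail_last b n z : blaschke_tail b n n.+1 z = 1%:M.
Proof. by rewrite /blaschke_tail subnn. Qed.

Lemma mx_cvg_blaschke_factor P (x : K) :
  mx_cvg x^' (blaschke_factor P) (blaschke_factor P x).
Proof.
apply: mx_cvgD; first exact: mx_cvg_cst.
apply: mx_cvgZ; last exact: mx_cvg_cst.
exact: nbhs_dnbhs.
Qed.

Lemma mx_cvg_blaschke_tail b n k (x : K) :
  mx_cvg x^' (blaschke_tail b n k) (blaschke_tail b n k x).
Proof.
rewrite /blaschke_tail; elim: (iota _ _) => [|j s IH] /=.
  exact: mx_cvg_cst.
by apply: mx_cvgM => //; exact: mx_cvg_blaschke_factor.
Qed.

(** Formulated on a punctured neighbourhood, because the later argument divides by powers of [z];
    [Y0] is a limit and need not be the value of [Y] at 0. *)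
Definition blaschke_factorization b n (phi : K -> 'M[K]_p)
    (Y : K -> 'M[K]_(p + p, p)) Y0 : Prop :=
  mx_cvg (0 : K)^' Y Y0 /\
  (0 : K)^' [set z : K | col_mx (phi z) 1%:M = blaschke_tail b n 0 z *m Y z].

(** With [V] the column of [P] and [Q], and D the lower half of [U *m V], the column of [phi] and
    the identity is [U *m V] times the inverse of D. The determinant condition at 0 makes that
    inverse converge. *)
Lemma blaschke_tail_factorization b n (U : K -> 'M[K]_(p + p))
    (P Q : K -> 'M[K]_p) (P0 Q0 : 'M[K]_p) (phi : K -> 'M[K]_p) :
  (forall z, cayley_regular z ->
     U z = blaschke_scale z ^+ n.+1 *: blaschke_tail b n 0 z) ->
  mx_cvg (0 : K)^' P P0 -> mx_cvg (0 : K)^' Q Q0 ->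
  \det (dlsubmx (U 0) *m P0 + drsubmx (U 0) *m Q0) != 0 ->
  (0 : K)^' [set z : K | phi z =
    (ulsubmx (U z) *m P z + ursubmx (U z) *m Q z)
    *m invmx (dlsubmx (U z) *m P z + drsubmx (U z) *m Q z)] ->
  exists (Y : K -> 'M[K]_(p + p, p)) Y0, blaschke_factorization b n phi Y Y0.
Proof.
move=> /near_cayley_regular UE PP0 QQ0 det0 phiE.
pose V z := col_mx (P z) (Q z); pose V0 := col_mx P0 Q0.
have VV0 : mx_cvg (0 : K)^' V V0 by exact: mx_cvg_col.
have denE A B C : dlsubmx A *m B + drsubmx A *m C =
    dsubmx (A *m col_mx B C) :> 'M[K]_p.
  by rewrite mulmx_submx_col col_mxKd.
have numE A B C : ulsubmx A *m B + ursubmx A *m C =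
    usubmx (A *m col_mx B C) :> 'M[K]_p.
  by rewrite mulmx_submx_col col_mxKu.
rewrite denE -/V0 in det0.
pose c z : K := blaschke_scale z ^+ n.+1.
have cvgc : c z @[z --> (0 : K)^'] --> c 0.
  apply: cvg_expr; apply: cvgM; first exact: cvg_cst.
  apply: cvgV; first by rewrite addr0 oner_neq0.
  by apply: cvgD; [exact: cvg_cst | exact: nbhs_dnbhs].
have cvgU : mx_cvg (0 : K)^' U (U 0).
  rewrite (nbhs_singleton UE); apply: near_mx_cvg (nbhs_dnbhs UE) _.
  by apply: (mx_cvgZ cvgc); exact: mx_cvg_blaschke_tail.
have cvgden : mx_cvg (0 : K)^' (fun z => dsubmx (U z *m V z))
    (dsubmx (U 0 *m V0)).
  by apply: mx_cvg_dsubmx; exact: mx_cvgM cvgU VV0.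
(* The scalar [c z] in front of the product of factors is moved into [Y]. *)
exists (fun z => c z *: (V z *m invmx (dsubmx (U z *m V z)))),
  (c 0 *: (V0 *m invmx (dsubmx (U 0 *m V0)))); split.
  by apply: (mx_cvgZ cvgc); apply: (mx_cvgM VV0); apply: mx_cvg_inv.
apply: filterS2 (filterI (nbhs_dnbhs UE) phiE)
  (cvgr_neq0 _ (cvg_det cvgden) det0) => z [Uz /= ->].
rewrite numE denE -/(V z).
rewrite /= -unitfE -unitmxE => den_unit.
(* The lower identity block is written as the denominator times its inverse, so that both blocks
   share the right factor. *)
rewrite -(mulmxV den_unit) -mul_col_mx vsubmxK {1}Uz.
by rewrite -scalemxAr -!scalemxAl mulmxA.
Qed.

End Factorization.

(** * Recovering the projections one factor at a time *)

Lemma mx_cvg_unique (K : numFieldType) (T : Type) (F : set_system T)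
    {FF : ProperFilter F} m n (f : T -> 'M[K]_(m, n)) A B :
  mx_cvg F f A -> mx_cvg F f B -> A = B.
Proof.
move=> fA fB; apply/matrixP => i j.
exact: (cvg_unique (@norm_hausdorff _ K) (fA i j) (fB i j)).
Qed.

(** Induction on [k] with two invariants: [close k], by which the tails differ by o(z^(l-k)), and
    [inj k], by which the value at 0 of the first tail has a left inverse. *)
Lemma row_proj_unique (K : numClosedFieldType) p (n n' l : nat)
    (b b' : nat -> 'M[K]_(p, p + p)) (Y Y' : K -> 'M[K]_(p + p, p)) Y0 Y0' X :
  (forall k, (k <= n)%N -> b k *m (b k)^t* = 1%:M) ->
  (forall k, (k <= n')%N -> b' k *m (b' k)^t* = 1%:M) ->
  mx_cvg (0 : K)^' Y Y0 -> mx_cvg (0 : K)^' Y' Y0' ->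
  X *m (blaschke_tail b n 0 0 *m Y0) = 1%:M ->
  mx_cvg (0 : K)^' (fun z : K => (z ^+ l)^-1 *:
    (blaschke_tail b n 0 z *m Y z - blaschke_tail b' n' 0 z *m Y' z)) 0 ->
  (l <= n)%N -> (l <= n')%N ->
  forall k, (k <= l)%N -> row_proj (b k) = row_proj (b' k).
Proof.
move=> b1 b'1 YY0 Y'Y0' XL d0 ln ln'.
pose V k z := blaschke_tail b n k z *m Y z.
pose V' k z := blaschke_tail b' n' k z *m Y' z.
pose L k := blaschke_tail b n k 0 *m Y0.
pose L' k := blaschke_tail b' n' k 0 *m Y0'.
have VL k : mx_cvg (0 : K)^' (V k) (L k).
  by apply: mx_cvgM => //; exact: mx_cvg_blaschke_tail.
have V'L' k : mx_cvg (0 : K)^' (V' k) (L' k).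
  by apply: mx_cvgM => //; exact: mx_cvg_blaschke_tail.
pose close k := mx_cvg (0 : K)^' (fun z : K => (z ^+ (l - k))^-1 *: (V k z - V' k z)) 0.
pose inj k := exists Xk, Xk *m L k = 1%:M.
(* At 0 the leading factor is the complementary projection, which [c k] annihilates from the
   left. *)
have kerb (c : nat -> 'M[K]_(p, p + p)) N k (Z : 'M[K]_(p + p, p)) : (k <= N)%N ->
    c k *m (c k)^t* = 1%:M -> c k *m (blaschke_tail c N k 0 *m Z) = 0.
  move=> kN c1; rewrite blaschke_tailS // /blaschke_factor scale0r addr0 !mulmxA.
  by rewrite mulmxBr mulmx1 mulmxA c1 mul1mx subrr !mul0mx.
have projE k : (k <= l)%N -> close k -> inj k ->
    row_proj (b k) = row_proj (b' k).
  move=> kl dk [Xk XkL].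
  have LL' : L k = L' k.
    have zl : (z : K) ^+ (l - k) @[z --> (0 : K)^'] --> (0 : K) ^+ (l - k).
      by apply: cvg_expr; exact: nbhs_dnbhs.
    (* Multiplying back by [z ^+ (l - k)], which has a finite limit, shows that the tails have the
       same limit at 0. *)
    have V0 : mx_cvg (0 : K)^' (fun z : K => V k z - V' k z) 0.
      move=> i j; have /(_ _ i j) : mx_cvg (0 : K)^' _ _ := mx_cvgZ zl dk.
      rewrite scaler0; apply: cvg_trans; apply: near_eq_cvg.
      apply: filterS (nbhs_dnbhs_neq (0 : K)) => z z0.
      by rewrite scalerA divff ?scale1r // expf_neq0.
    apply: (@mx_cvg_unique _ _ (0 : K)^' _ _ _ (V k)) => //.
    move=> i j; have /(_ _ i j) : mx_cvg (0 : K)^' _ _ := mx_cvgD V0 (V'L' k).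
    rewrite add0r; apply: cvg_trans; apply: near_eq_cvg; near=> z.
    by rewrite subrK.
  apply: (projection_eq_of_kernel XkL); [exact/b1/(leq_trans kl)
    | exact/b'1/(leq_trans kl) | |].
    by apply: kerb; [exact: leq_trans ln | exact/b1/(leq_trans kl)].
  by rewrite LL'; apply: kerb; [exact: leq_trans ln' | exact/b'1/(leq_trans kl)].
suff H k : (k <= l)%N -> close k /\ inj k.
  by move=> k kl; have [] := H k kl; exact: projE.
elim: k => [_|k IH kl]; first by split; [rewrite /close subn0 | exists X].
have [dk [Xk XkL]] := IH (ltnW kl).
have PP' := projE k (ltnW kl) dk (ex_intro _ Xk XkL).
have kn : (k <= n)%N := leq_trans (ltnW kl) ln.
have kn' : (k <= n')%N := leq_trans (ltnW kl) ln'.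
set P := row_proj (b k) in PP' *.
have Pid : P *m P = P by apply/row_proj_idem/b1.
split; last first.
  (* Since [L k] is the leading factor at 0 times [L k.+1], that factor is absorbed into the left
     inverse. *)
  exists (Xk *m blaschke_factor P 0).
  by rewrite -XkL /L (blaschke_tailS b _ kn) !mulmxA.
(* The inverse of the leading factor has a simple pole at 0. One power of [z] turns it into z(I - P)
   + P, which tends to [P]. *)
have zP : mx_cvg (0 : K)^' (fun z : K => z *: blaschke_factor P z^-1) P.
  have : mx_cvg (0 : K)^' (fun z : K => z *: (1%:M - P) + P) (0 *: (1%:M - P) + P).
    apply: mx_cvgD; last exact: mx_cvg_cst.
    apply: mx_cvgZ; last exact: mx_cvg_cst.
    exact: nbhs_dnbhs.
  rewrite scale0r add0r => H i j; move: (H i j).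
  apply: cvg_trans; apply: near_eq_cvg.
  apply: filterS (nbhs_dnbhs_neq (0 : K)) => z z0; congr (fun_of_matrix _ i j).
  by rewrite /blaschke_factor [in RHS]scalerDr scalerA mulfV // scale1r.
move=> i j; have /(_ _ i j) : mx_cvg (0 : K)^' _ _ := mx_cvgM zP dk.
rewrite mulmx0; apply: cvg_trans; apply: near_eq_cvg.
apply: filterS (nbhs_dnbhs_neq (0 : K)) => z z0; congr (fun_of_matrix _ i j).
(* By [PP'] both tails begin with the same factor, so a single inverse strips it from their
   difference. *)
rewrite /V /V' (blaschke_tailS b _ kn) (blaschke_tailS b' _ kn') -PP' -/P.
rewrite -!mulmxA -mulmxBr -scalemxAl -scalemxAr mulmxA blaschke_factorK // mul1mx.
rewrite scalerA; congr (_ *: _).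
(* The power of [z] spent on the pole lowers the exponent from l - k to l - (k + 1). *)
by rewrite -(subnSK kl) exprS invfM mulrA mulfV // mul1r.
Unshelve. all: by end_near.
Qed.

(** The lower block of the factored column is constantly the identity, and this persists in the
    limit; it starts the induction on left inverses. *)
Lemma left_inverse_of_factorization (K : numClosedFieldType) p n
    (b : nat -> 'M[K]_(p, p + p)) (phi : K -> 'M[K]_p) Y Y0 :
  blaschke_factorization b n phi Y Y0 ->
  row_mx 0 1%:M *m (blaschke_tail b n 0 0 *m Y0) = 1%:M.
Proof.
move=> [cvgY phiE].
have cvgL : mx_cvg (0 : K)^' (fun z => dsubmx (blaschke_tail b n 0 z *m Y z))
    (dsubmx (blaschke_tail b n 0 0 *m Y0)).
  by apply: mx_cvg_dsubmx; apply: (mx_cvgM _ cvgY); exact: mx_cvg_blaschke_tail.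
rewrite -[blaschke_tail b n 0 0 *m Y0]vsubmxK mul_row_col mul0mx add0r mul1mx.
apply: (mx_cvg_unique cvgL).
apply: (@near_mx_cvg _ _ _ _ _ _ _ (fun=> 1%:M)); last exact: mx_cvg_cst.
by apply: filterS phiE => z <-; rewrite col_mxKd.
Qed.

Lemma mx_cvg_factorization_diff (K : numClosedFieldType) p m n l
    (b b' : nat -> 'M[K]_(p, p + p)) (phi phi' : K -> 'M[K]_p) Y Y' Y0 Y0' :
  blaschke_factorization b m phi Y Y0 ->
  blaschke_factorization b' n phi' Y' Y0' ->
  mx_cvg (0 : K)^' (fun z : K => (z ^+ l)^-1 *: (phi z - phi' z)) 0 ->
  mx_cvg (0 : K)^' (fun z : K => (z ^+ l)^-1 *:
    (blaschke_tail b m 0 z *m Y z - blaschke_tail b' n 0 z *m Y' z)) 0.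
Proof.
move=> [_ phiE] [_ phi'E] cvg0; rewrite -[0 in X in mx_cvg _ _ X]col_mx0.
apply: (@near_mx_cvg _ _ _ _ _ _ _
    (fun z => col_mx ((z ^+ l)^-1 *: (phi z - phi' z)) 0)).
  apply: filterS2 phiE phi'E => z <- <-.
  by rewrite opp_col_mx add_col_mx subrr scale_col_mx scaler0.
by apply: mx_cvg_col => //; exact: mx_cvg_cst.
Qed.

(** * From matrix Taylor coefficients to entrywise statements *)

Section TaylorCoefficients.
Variables (R : realType) (m n : nat).
Local Notation K := (Cplx R).
Implicit Types (f : K -> 'M[K]_(m, n)) (a : nat -> 'M[K]_(m, n)).

Lemma taylor_coefs_entry f (w : K) a i j : taylor_coefs f w a ->
  \forall z \near w, [series (z - w) ^+ k * a k i j]_k @ \oo --> f z i j.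
Proof.
apply: filterS => z fz.
rewrite (_ : series _ =
    (fun A : 'M[K]_(m, n) => A i j) \o [series (z - w) ^+ k *: a k]_k).
  exact: cvg_comp fz (@coord_continuous _ _ _ i j _).
apply: funext; elim=> [|N IH].
  by rewrite /series /= !big_nil mxE.
by rewrite seriesSr IH /= seriesSr !mxE.
Qed.

Lemma mx_cvg_analytic f (w : K) : analytic_near f w -> mx_cvg (nbhs w) f (f w).
Proof.
move=> /nbhs_singleton[a fa] i j.
exact: (cvg_pseries (taylor_coefs_entry i j fa)).
Qed.

End TaylorCoefficients.

(** * The Cayley transform near 0 *)

Section Cayley.
Variable R : realType.
Local Notation K := (Cplx R).
Implicit Types z : K.

Lemma cayley0 : cayley (0 : K) = 'i.
Proof. by rewrite /cayley subr0 addr0 divr1 mulr1. Qed.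

Lemma cvg_cayley : cayley z @[z --> (0 : K)^'] --> ('i : K).
Proof.
rewrite -[in X in _ --> X]cayley0 /cayley.
apply: cvgM; first exact: cvg_cst.
apply: cvgM; first by apply: cvgD; [exact: cvg_cst | exact: nbhs_dnbhs].
apply: cvgV; first by rewrite subr0 oner_neq0.
by apply: cvgB; [exact: cvg_cst | exact: nbhs_dnbhs].
Qed.

End Cayley.

(** * Factorization of Weyl functions *)

Section WeylFunctions.
Variables (R : realType) (p : nat).
Local Notation K := (Cplx R).

(** Taking adjoints of the recurrence at the conjugate point turns each step into right
    multiplication by I + (i/lambda) C_k, and i/lambda = (1 - z)/(1 + z). *)
Lemma calW_cayley n (C : nat -> 'M[K]_(p + p)) (b : nat -> 'M[K]_(p, p + p))
    W (z : K) :
  (forall k, (k <= n)%N -> C k = (C k)^t*) ->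
  (forall k, (k <= n)%N -> C k = 1%:M - 2%:R *: row_proj (b k)) ->
  normalized_solution n C W -> cayley_regular z ->
  calW n W (cayley z) = blaschke_scale z ^+ n.+1 *: blaschke_tail b n 0 z.
Proof.
move=> CC CE solW [z1 z1'].
have i0 : ('i : K) != 0 by exact: neq0Ci.
pose mu : K := Num.conj (cayley z).
have mu0 : mu != 0 by rewrite conjC_eq0 !mulf_neq0 ?invr_neq0.
have [W0 WS] := solW mu mu0.
pose c := blaschke_scale z.
have adjD (A B : 'M[K]_(p + p)) : (A + B)^t* = A^t* + B^t*.
  by apply/matrixP => i j; rewrite !mxE rmorphD.
have adjZ (x : K) (A : 'M[K]_(p + p)) : (x *: A)^t* = Num.conj x *: A^t*.
  by apply/matrixP => i j; rewrite !mxE rmorphM.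
have adjM (A B : 'M[K]_(p + p)) : (A *m B)^t* = B^t* *m A^t*.
  by rewrite trmx_mul map_mxM.
have step k : (k <= n)%N ->
    (W k.+1 mu)^t* = c *: ((W k mu)^t* *m blaschke_factor (row_proj (b k)) z).
  move=> kn; have /eqP := WS k kn; rewrite subr_eq => /eqP ->.
  rewrite adjD adjZ adjM -CC // /mu rmorphN fmorph_div /= conjCK conjCi.
  rewrite mulNr opprK.
  have -> : 'i / cayley z = (1 - z) / (1 + z).
    by rewrite /cayley; field; rewrite ?i0 ?z1 ?z1'.
  by rewrite (CE k kn) -/mu addrC mulmx_blaschke_factor.
(* Induction on the number of factors, so [k] descends from n + 1, where the tail is empty, to 0,
   where [W] is the identity. *)
have inv k : (k <= n.+1)%N -> (W n.+1 mu)^t* =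
    c ^+ (n.+1 - k) *: ((W k mu)^t* *m blaschke_tail b n k z).
  move kE : (n.+1 - k)%N => m; elim: m k kE => [|m IH] k kE kn.
    have -> : k = n.+1 by apply/eqP; rewrite eqn_leq kn -subn_eq0 kE.
    by rewrite blaschke_tail_last mulmx1 expr0 scale1r.
  have kn' : (k <= n)%N by rewrite -ltnS -subn_gt0 kE.
  rewrite (IH k.+1) ?subnS ?kE // (step k kn') (blaschke_tailS b z kn').
  by rewrite -scalemxAl scalerA -exprSr mulmxA.
by have := inv 0%N (leq0n _); rewrite subn0 W0 trmx1 map_mx1 mul1mx.
Qed.

Lemma mx_cvg_cayley (P : K -> 'M[K]_p) : analytic_near P 'i ->
  mx_cvg (0 : K)^' (fun z => P (cayley z)) (P (cayley 0)).
Proof.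
move=> anP; rewrite cayley0 => i j.
have cvgP : mx_cvg (nbhs ('i : K)) P (P 'i).
  exact: mx_cvg_analytic.
exact: (@cvg_comp _ _ _ _ (fun x => P x i j) _ _ _ (@cvg_cayley R) (cvgP i j)).
Qed.

Lemma is_weyl_factorization n (C : nat -> 'M[K]_(p + p)) phi :
  conditions_D n C -> is_weyl n C phi ->
  exists (b : nat -> 'M[K]_(p, p + p)) (Y : K -> 'M[K]_(p + p, p)) Y0,
    [/\ forall k, (k <= n)%N -> C k = 1%:M - 2%:R *: row_proj (b k),
        forall k, (k <= n)%N -> b k *m (b k)^t* = 1%:M
      & blaschke_factorization b n (fun z => phi (cayley z)) Y Y0].
Proof.
move=> [Csym [b [CE b1 _ _]]] [W [P [Q [solW [anP anQ den0] phiE]]]].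
have UE z : cayley_regular z -> calW n W (cayley z) =
    blaschke_scale z ^+ n.+1 *: blaschke_tail b n 0 z.
  by apply: calW_cayley CE solW => k /Csym[].
(* Admissibility at 'i becomes the determinant condition at [z = 0]. *)
rewrite -cayley0 in den0.
have [Y [Y0 YE]] := blaschke_tail_factorization UE (mx_cvg_cayley anP)
  (mx_cvg_cayley anQ) den0 (cvg_cayley phiE).
by exists b, Y, Y0.
Qed.

End WeylFunctions.

(** * Comparison of the two systems *)

(** Agreement of the coefficients 0 to l gives a difference of order z^(l+1), one power more than is
    divided out. *)
Lemma mx_cvg_taylor_diff (R : realType) m n l
    (f g : Cplx R -> 'M[Cplx R]_(m, n)) a c :
  taylor_coefs f 0 a -> taylor_coefs g 0 c ->
  (forall k, (k <= l)%N -> a k = c k) ->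
  mx_cvg (0 : Cplx R)^' (fun z => (z ^+ l)^-1 *: (f z - g z)) 0.
Proof.
move=> fa gc ac i j.
have [k kl|M M_ge0 fgM] := near_pseries_diff_le (m := l.+1)
    (taylor_coefs_entry i j fa) (taylor_coefs_entry i j gc).
  by rewrite ac.
rewrite mxE; under eq_cvg do rewrite !mxE.
apply: cvg_div_exp0 M_ge0 _.
by apply: filterS fgM => z; rewrite subr0.
Qed.

Theorem theorem3p5 (R : realType) (p nt nh l : nat)
    (Ct Ch : nat -> 'M[Cplx R]_(p + p))
    (phit phih : Cplx R -> 'M[Cplx R]_p)
    (alphat alphah : nat -> 'M[Cplx R]_p) :
  conditions_D nt Ct ->
  conditions_D nh Ch ->
  is_weyl nt Ct phit ->
  is_weyl nh Ch phih ->
  taylor_coefs (fun z => phit (cayley z)) 0 alphat ->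
  taylor_coefs (fun z => phih (cayley z)) 0 alphah ->
  (l <= nt)%N ->
  (l <= nh)%N ->
  (forall k, (k <= l)%N -> alphat k = alphah k) ->
  forall k, (k <= l)%N -> Ct k = Ch k.
Proof.
move=> Dt Dh weylt weylh taylort taylorh lnt lnh alphaE k kl.
have [b [Y [Y0 [CtE b1 tY]]]] := is_weyl_factorization Dt weylt.
have [b' [Y' [Y0' [ChE b'1 hY']]]] := is_weyl_factorization Dh weylh.
(* The matrices [b k] and [b' k] themselves may differ by a unitary left factor, so only their
   projections are compared. *)
suff projE : row_proj (b k) = row_proj (b' k).
  by rewrite (CtE k (leq_trans kl lnt)) (ChE k (leq_trans kl lnh)) projE.
have alpha_diff := mx_cvg_taylor_diff taylort taylorh alphaE.
exact: (row_proj_unique b1 b'1 (proj1 tY) (proj1 hY')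
  (left_inverse_of_factorization tY)
  (mx_cvg_factorization_diff tY hY' alpha_diff) lnt lnh kl).
Qed.
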